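(* Let $q=p^l$ be a prime power ($p$ prime) and $\mathbb{F}_q$ the finite field of order $q$. Let $\mathcal{D}$ be a $1$-$(v,k,r)$ design with blocks $B_1,\ldots,B_b$ and let $a,d\in\mathbb{F}_p$ be such that $k\equiv a\pmod p$ and $|B_i\cap B_j|\equiv d\pmod p$ for all $i,j\in\{1,\ldots,b\}$, $i\neq j$. Let $G$ be an automorphism group of $\mathcal{D}$ which acts on $\mathcal{D}$ with $n$ point orbits, all of length $w$, and $m$ block orbits, all of length $w$, and let $O$ be the orbit matrix of $\mathcal{D}$ under the action of $G$. Suppose $a=d$. (a) If $p\mid w$, then the linear code spanned by the rows of $O$ is a self-orthogonal $[n,\operatorname{rank} O]$ code over the field $\mathbb{F}_q$. (b) If $p\nmid w$, then the linear code spanned by the rows of the matrix $[O,\ \sqrt{-wd}\,\mathbf{1}]$ is a self-orthogonal $[n+1,\operatorname{rank} O]$ code over the field $\mathbb{F}$, where $\mathbb{F}=\mathbb{F}_q$ if $-wd$ is a square in $\mathbb{F}_q$, and $\mathbb{F}=\mathbb{F}_{q^2}$ otherwise. Suppose $a\neq d$. (a) If $p\mid w$, then the linear code spanned by the rows of the matrix $[\sqrt{d-a}\,I_m,\ O]$ is a self-orthogonal $[m+n,m]$ code over the field $\mathbb{F}$, where $\mathbb{F}=\mathbb{F}_q$ if $d-a$ is a square in $\mathbb{F}_q$, and $\mathbb{F}=\mathbb{F}_{q^2}$ otherwise. If $m=n$, the obtained code is self-dual. (b) If $p\mid w-1$, then the linear code spanned by the rows of the matrix $[\sqrt{wd-a}\,I_m,\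 O,\ \sqrt{-wd}\,\mathbf{1}]$ is a self-orthogonal $[m+n+1,m]$ code over the field $\mathbb{F}$, where $\mathbb{F}=\mathbb{F}_q$ if $wd-a$ and $-wd$ are squares in $\mathbb{F}_q$, and $\mathbb{F}=\mathbb{F}_{q^2}$ otherwise. (c) If $p\nmid w$ and $p\nmid w-1$, then the linear code spanned by the rows of the matrix $[\sqrt{d-a}\,I_m,\ O,\ \sqrt{-wd}\,\mathbf{1}]$ is a self-orthogonal $[m+n+1,m]$ code over the field $\mathbb{F}$, where $\mathbb{F}=\mathbb{F}_q$ if $d-a$ and $-wd$ are squares in $\mathbb{F}_q$, and $\mathbb{F}=\mathbb{F}_{q^2}$ otherwise.
   Context: A $1$-$(v,k,r)$ design is a finite incidence structure with $v$ points and $b$ blocks such that every block is incident with exactly $k$ points and every point is incident with exactly $r$ blocks. For blocks $B_i,B_j$, $|B_i\cap B_j|$ is the number of points incident with both. An automorphism group of $\mathcal{D}$ is a group of incidence-preserving bijections (points to points, blocks to blocks) of $\mathcal{D}$. If $G$ has point orbits $\mathcal{V}_1,\ldots,\mathcal{V}_n$ and block orbits $\mathcal{B}_1,\ldots,\mathcal{B}_m$, the orbit matrix is the $m\times n$ matrix $[a_{i,j}]$ where $a_{i,j}$ is the number of points of $\mathcal{V}_j$ incident with a block of $\mathcal{B}_i$ (independent of the chosen block); its entries are viewed, and its rank is computed, in the field under consideration. $I_m$ is the identity matrix, $\mathbf{1}$ the all-one column, and $[X,Y,\ldots]$ denotes horizontal concatenation. For $c\in\mathbb{F}_p$, viewed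 in $\mathbb{F}$, $\sqrt{c}$ denotes an element of $\mathbb{F}$ whose square is $c$. An $[N,K]$ code has length $N$ and dimension $K$. A code $C\subseteq\mathbb{F}^N$ is self-orthogonal if $C\subseteq C^\perp$ and self-dual if $C=C^\perp$, where $C^\perp$ is the dual under the standard (bilinear) inner product. *)

(* Defs.v *)
From mathcomp Require Export all_boot all_order all_algebra all_fingroup.

Set Implicit Arguments.
Unset Strict Implicit.
Unset Printing Implicit Defensive.

Import GRing.Theory.
Local Open Scope ring_scope.

Section Design.

Variables (V B : finType) (inc : V -> B -> bool).

(* Blocks form a type of their own, so distinct blocks may be incident with
   the same points. *)
Definition points_of (y : B) : {set V} := [set x | inc x y].
Definition blocks_of (x : V) : {set B} := [set y | inc x y].

Definition one_design (v k r : nat) : Prop :=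
  [/\ #|V| = v,
      forall y : B, #|points_of y| = k
    & forall x : V, #|blocks_of x| = r].

Definition design_aut : {set {perm V} * {perm B}} :=
  [set g : {perm V} * {perm B} | [forall x, forall y, inc (g.1 x) (g.2 y) == inc x y]].

(* 'P is the natural action of a permutation group; it is pulled back along
   the two projections of {perm V} * {perm B}. *)
Definition point_orbits (G : {group {perm V} * {perm B}}) : {set {set V}} :=
  orbit ('P \o @fst {perm V} {perm B})%act G @: [set: V].

Definition block_orbits (G : {group {perm V} * {perm B}}) : {set {set B}} :=
  orbit ('P \o @snd {perm V} {perm B})%act G @: [set: B].

Definition enumerates (T : finType) (n : nat) (f : 'I_n -> {set T})
    (P : {set {set T}}) : Prop :=
  injective f /\ f @: [set: 'I_n] = P.

(* The block of the i-th orbit is chosen by pick; orbit_matrixE below shows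
   that the choice is immaterial.  The default 0 is never reached, orbits being
   nonempty. *)
Definition orbit_matrix (m n : nat) (Bo : 'I_m -> {set B})
    (Vo : 'I_n -> {set V}) : 'M[nat]_(m, n) :=
  \matrix_(i, j) (if [pick y in Bo i] is Some y
                  then #|Vo j :&: points_of y| else 0%N).

Lemma orbit_matrixE (G : {group {perm V} * {perm B}}) (m n : nat)
    (Bo : 'I_m -> {set B}) (Vo : 'I_n -> {set V}) (i : 'I_m) (j : 'I_n)
    (y : B) :
  G \subset design_aut ->
  enumerates Bo (block_orbits G) -> enumerates Vo (point_orbits G) ->
  y \in Bo i ->
  orbit_matrix Bo Vo i j = #|Vo j :&: points_of y|.
Proof.
move=> sGA [_ defB] [_ defV] Biy; rewrite mxE.
case: pickP => [z Biz | /(_ y)]; last by rewrite Biy.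
have sG1 : G \subset act_dom ('P \o @fst {perm V} {perm B})%act.
  by apply/subsetP=> g _; rewrite !inE.
have sG2 : G \subset act_dom ('P \o @snd {perm V} {perm B})%act.
  by apply/subsetP=> g _; rewrite !inE.
have /imsetP[y0 _ Dy0] : Bo i \in block_orbits G by rewrite -defB imset_f.
have /imsetP[x0 _ Dx0] : Vo j \in point_orbits G by rewrite -defV imset_f.
have : y \in orbit ('P \o @snd {perm V} {perm B})%act G z.
  by move: Biy Biz; rewrite Dy0 => y0y /(orbit_in_eqP sG2) ->.
case/orbitP=> g Gg <-.
have /(subsetP sGA) := Gg; rewrite inE => /forallP Hg.
have Vg x : (g.1 x \in Vo j) = (x \in Vo j).
  by rewrite Dx0; apply: (orbit_actr_in _ _ _ sG1 Gg).
rewrite -(card_imset _ (@perm_inj _ g.1)); apply: eq_card => x.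
have Hx : (x \in Vo j :&: points_of (g.2 z))
        = (g.1^-1%g x \in Vo j :&: points_of z).
  have /forallP/(_ z)/eqP := Hg (g.1^-1%g x); rewrite permKV => Ieq.
  by rewrite !inE -Ieq -[in RHS]Vg permKV.
rewrite [RHS]Hx; apply/imsetP/idP => [[x1 Vx1 ->] | Vx]; first by rewrite permK.
by exists (g.1^-1%g x); rewrite ?permKV.
Qed.

End Design.

Section Codes.

Variable F : finFieldType.

Definition row_code (m N : nat) (M : 'M[F]_(m, N)) : {vspace 'rV[F]_N} :=
  <<[seq row i M | i <- enum 'I_m]>>%VS.

Definition dotp (N : nat) (x y : 'rV[F]_N) : F := \sum_i x 0 i * y 0 i.

Definition dual_code (N : nat) (C : {vspace 'rV[F]_N}) : {pred 'rV[F]_N} :=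
  [pred x | [forall (y | y \in C), dotp x y == 0]].

Definition self_orthogonal (N : nat) (C : {vspace 'rV[F]_N}) : Prop :=
  {subset C <= dual_code C}.

Definition self_dual (N : nat) (C : {vspace 'rV[F]_N}) : Prop :=
  C =i dual_code C.

(* The length N is carried by the type of C. *)
Definition self_orthogonal_code (N K : nat) (C : {vspace 'rV[F]_N}) : Prop :=
  self_orthogonal C /\ \dim C = K.

Definition nat_mx (m n : nat) (A : 'M[nat]_(m, n)) : 'M[F]_(m, n) :=
  map_mx (fun x : nat => x%:R) A.

(* An element of the prime field viewed in F; this is the inclusion when F has
   characteristic p. *)
Definition in_field (p : nat) (c : 'F_p) : F := (val c)%:R.

Definition is_sqrt (p : nat) (c : 'F_p) (s : F) : Prop := s ^+ 2 = in_field c.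

Definition is_square (p : nat) (c : 'F_p) : bool :=
  [exists s : F, s ^+ 2 == in_field c].

End Codes.

(* A finite field being determined up to isomorphism by its order, this says
   that F is F_q if all the elements of cs are squares in F_q, and F_(q^2)
   otherwise. *)
Definition sqrt_field (p : nat) (Fq F : finFieldType) (cs : seq 'F_p) : Prop :=
  #|F| = if all (@is_square Fq p) cs then #|Fq| else (#|Fq| ^ 2)%N.

(* Main.v *)
Require Import Defs.
From mathcomp Require Import cyclic finfield.
Set Implicit Arguments.
Unset Strict Implicit.
Unset Printing Implicit Defensive.
Import GRing.Theory.
Local Open Scope ring_scope.

(** Over a field [F] of characteristic [p], everything follows from one Gram
    matrix identity,
      [O *m O^T = (a - d)%:M + const_mx (w d)]
    ([gram_orbit_mx]). To see it, fix a block [y] in the orbit [Bo i] and count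
    in two ways the pairs of a block [y'] of [Bo i'] and a common point of [y]
    and [y']. Since all orbits have the same length, a point of [Vo j] lies on
    as many blocks of [Bo i'] as a block of [Bo i'] has points in [Vo j], so the
    count is the scalar product of the rows [i] and [i'] of [O]
    ([orbit_matrix_gram]). It is also a sum of intersection sizes, known modulo
    [p]: [w d] if [i] differs from [i'], and [a + (w - 1) d] otherwise.

    Appending a block [s%:M] adds [s ^+ 2] on the diagonal of the Gram matrix,
    and appending a constant column [t] adds [t ^+ 2] everywhere. The square
    roots are chosen to cancel the two terms above, and a code whose generator
    matrix has zero Gram matrix is self-orthogonal
    ([self_orthogonal_row_code]). The dimension is the rank of the generator
    matrix ([dim_row_code]): it is [m] as soon as there is a block [s%:M] with
    [s] nonzero, and for [a = d] the constant column is a multiple of the sum of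
    the columns of [O], because each row of [O] adds up to [a]
    ([orbit_mx_row_sum]).

    The required square roots exist in [F] by Euler's criterion: being a square
    in a finite field of given odd order is, for an element of the prime field,
    a condition on one of its powers in the prime field itself
    ([sqrt_field_sqrt]). *)

(** * The prime field inside a finite field *)

Lemma in_field0 (p : nat) (F : finFieldType) : @in_field F p 0 = 0.
Proof. by []. Qed.

Section PrimeField.

Variables (p : nat) (p_prime : prime p) (F : finFieldType).
Hypothesis charF : p \in [pchar F].

(** The canonical map from the prime field is reduction of natural numbers, so
    every identity below is the corresponding identity between casts of natural
    numbers. *)
Lemma in_field_nat (n : nat) : @in_field F p n%:R = n%:R.
Proof. by rewrite /in_field /= val_Fp_nat // GRing.natr_mod_pchar. Qed.

Lemma Fp_natE (c : 'F_p) : c = (val c)%:R.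
Proof. by rewrite natr_Zp. Qed.

Lemma in_fieldD (c e : 'F_p) :
  @in_field F p (c + e) = in_field F c + in_field F e.
Proof. by rewrite (Fp_natE c) (Fp_natE e) -natrD !in_field_nat natrD. Qed.

Lemma in_fieldN (c : 'F_p) : @in_field F p (- c) = - in_field F c.
Proof.
by apply/eqP; rewrite -addr_eq0 -in_fieldD addNr in_field0.
Qed.

Lemma in_fieldX (c : 'F_p) (i : nat) :
  @in_field F p (c ^+ i) = in_field F c ^+ i.
Proof.
by rewrite (Fp_natE c) -natrX !in_field_nat natrX.
Qed.

Lemma in_field_eq0 (c : 'F_p) : (@in_field F p c == 0) = (c == 0).
Proof.
rewrite -(dvdn_pcharf charF) [in RHS](Fp_natE c).
by rewrite -(dvdn_pcharf (pchar_Fp p_prime)).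
Qed.

Lemma in_field_eq1 (c : 'F_p) : (@in_field F p c == 1) = (c == 1).
Proof.
rewrite -subr_eq0 -[1 in LHS](in_field_nat 1) -in_fieldN -in_fieldD.
by rewrite in_field_eq0 subr_eq0.
Qed.

End PrimeField.

(** * Square roots of prime field elements *)

Lemma card_finField_gt0 (F : finFieldType) : (0 < #|F|)%N.
Proof. by apply/card_gt0P; exists 0. Qed.

Lemma expf_card_pred (F : finFieldType) (x : F) : x != 0 -> x ^+ #|F|.-1 = 1.
Proof.
move=> nz_x; apply: (mulfI nz_x).
by rewrite -exprS mulr1 (prednK (card_finField_gt0 F)) expf_card.
Qed.

Lemma finField_primitive (F : finFieldType) :
  exists z : F, (#|F|.-1).-primitive_root z.
Proof.
pose rs := enum [pred x : F | x != 0].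
have size_rs : size rs = #|F|.-1.
  rewrite -cardE (cardD1 0 F) inE.
  by apply: eq_card => x; rewrite !inE andbT.
have pos : (0 < #|F|.-1)%N.
  by rewrite -size_rs -cardE; apply/card_gt0P; exists 1; rewrite inE oner_neq0.
have /hasP[z _ pz] : has (#|F|.-1).-primitive_root rs; last by exists z.
apply: has_prim_root => //; rewrite ?size_rs ?enum_uniq //.
by apply/allP=> x; rewrite mem_enum inE => /expf_card_pred/unity_rootP.
Qed.

(** Stated through a power of [x] so that, for [x] in the prime field, being a
    square becomes a condition that can be moved between fields. *)
Lemma euler_criterion (F : finFieldType) (x : F) :
  odd #|F| -> x != 0 ->
  (exists s : F, s ^+ 2 = x) <-> x ^+ (#|F|.-1)./2 = 1.
Proof.
move=> oddF nz_x.
have half : ((#|F|.-1)./2 * 2 = #|F|.-1)%N.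
  by rewrite muln2 even_halfK // -subn1 oddB ?card_finField_gt0 // oddF.
split=> [[s sx] | x1].
  rewrite -sx -exprM mulnC half expf_card_pred //.
  by apply: contraNneq nz_x => s0; rewrite -sx s0 expr0n.
have [z pz] := finField_primitive F.
have [i xzi] := prim_rootP pz (expf_card_pred nz_x).
have : (#|F|.-1 %| i * (#|F|.-1)./2)%N.
  by rewrite (prim_order_dvd pz) exprM -xzi x1.
have pos : (0 < (#|F|.-1)./2)%N.
  rewrite lt0n; apply: contraTneq (prim_order_gt0 pz) => h0.
  by rewrite -half h0.
rewrite -[X in (X %| _)%N]half mulnC dvdn_pmul2r // => /dvdnP[j ij].
by exists (z ^+ j); rewrite -exprM -ij -xzi.
Qed.

Lemma sqrt_field_pchar (p l : nat) (Fq F : finFieldType) (cs : seq 'F_p) :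
  prime p -> #|Fq| = (p ^ l)%N -> sqrt_field Fq F cs -> p \in [pchar F].
Proof.
move=> p_prime cardq; rewrite /sqrt_field cardq -expnM.
by case: ifP => _ cF; apply: card_finPcharP cF p_prime.
Qed.

(** For odd [q = #|Fq|] and nonzero [c], Euler's criterion makes both cases a
    statement about powers of [c] in the prime field. If [c] is a square in
    [Fq], the same power is [1] in [F], which has the same order. If [F] has
    order [q ^ 2], then [(q ^ 2 - 1) / 2] is a multiple of [q - 1], and
    [c ^+ (q - 1) = 1]. *)
Lemma sqrt_field_sqrt (p l : nat) (Fq F : finFieldType) (cs : seq 'F_p)
    (c : 'F_p) :
  prime p -> #|Fq| = (p ^ l)%N -> sqrt_field Fq F cs -> c \in cs ->
  exists s : F, is_sqrt c s.
Proof.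
move=> p_prime cardq sF c_cs.
have charq := card_finPcharP cardq p_prime.
have charF := sqrt_field_pchar p_prime cardq sF.
have [-> | nz_c] := eqVneq c 0.
  by exists 0; rewrite /is_sqrt expr0n; apply/esym/eqP; rewrite in_field_eq0.
have [p2 | p_odd] := even_prime p_prime.
  (* In characteristic 2, c is its own square root. *)
  exists (in_field F c); rewrite /is_sqrt -in_fieldX //; congr in_field.
  by rewrite (_ : 2 = #|'F_p|)%N ?expf_card // card_Fp.
have oddq : odd #|Fq| by rewrite cardq oddX p_odd orbT.
have nzF : in_field F c != 0 by rewrite in_field_eq0.
have nzq : in_field Fq c != 0 by rewrite in_field_eq0.
have toF i : in_field Fq c ^+ i = 1 -> in_field F c ^+ i = 1.
  move/eqP; rewrite -in_fieldX // in_field_eq1 // => /eqP ci.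
  by apply/eqP; rewrite -in_fieldX // in_field_eq1 // ci.
move: sF; rewrite /sqrt_field.
case: ifP => [/allP/(_ c c_cs)/existsP[s /eqP sc] | _] cardF.
  apply/euler_criterion => //; first by rewrite cardF.
  by rewrite cardF; apply: toF; apply/euler_criterion => //; exists s.
apply/euler_criterion => //; first by rewrite cardF oddX oddq orbT.
have -> : (#|F|.-1)./2 = (#|Fq|.-1 * (#|Fq|.+1)./2)%N.
  rewrite cardF -subn1 -[X in (_ - X)%N](exp1n 2) subn_sqr subn1 addn1.
  by rewrite -[in LHS](@even_halfK #|Fq|.+1) /= ?oddq // -doubleMr doubleK.
rewrite exprM; apply: (etrans _ (expr1n _ _)); congr (_ ^+ _); apply: toF.
exact: expf_card_pred.
Qed.

(** * Codes spanned by the rows of a matrix *)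

Section RowCode.

Variable F : finFieldType.

Lemma mem_row_code (m N : nat) (M : 'M[F]_(m, N)) (x : 'rV[F]_N) :
  (x \in row_code M) = (x <= M)%MS.
Proof.
apply/idP/submxP => [|[u ->]].
  rewrite /row_code span_def big_map big_enum /= => /memv_sumP[f fM ->].
  have {}fM i : {a | f i = a *: row i M}.
    by have /vlineP := fM i isT; apply: sig_eqW.
  exists (\row_i sval (fM i)); rewrite mulmx_sum_row.
  by apply: eq_bigr => i _; rewrite mxE; case: (fM i).
rewrite mulmx_sum_row; apply: memv_suml => i _; apply/memvZ/memv_span.
by apply/mapP; exists i; rewrite ?mem_enum.
Qed.

(** The rows of [row_base M] are independent and span the same code. *)
Lemma dim_row_code (m N : nat) (M : 'M[F]_(m, N)) :
  \dim (row_code M) = \rank M.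
Proof.
have eq_base : row_code M = row_code (row_base M).
  by apply/vspaceP=> x; rewrite !mem_row_code eq_row_base.
pose X := [tuple row i (row_base M) | i < \rank M].
have codeX : row_code (row_base M) = <<X>>%VS by [].
rewrite eq_base codeX; suff /eqP-> : free X by rewrite size_tuple.
apply/freeP=> c c0 i.
have : (\row_j c j) *m row_base M = 0.
  rewrite mulmx_sum_row; apply: etrans c0; apply: eq_bigr => j _.
  by rewrite mxE -tnth_nth tnth_mktuple.
move/eqP; rewrite (mulmx_free_eq0 _ (row_base_free M)) => /eqP/rowP/(_ i).
by rewrite !mxE.
Qed.

Lemma dotp_mulmx (N : nat) (x y : 'rV[F]_N) : dotp x y = (x *m y^T) 0 0.
Proof. by rewrite mxE; apply: eq_bigr => i _; rewrite mxE. Qed.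

Lemma mem_dual_row_code (m N : nat) (M : 'M[F]_(m, N)) (x : 'rV[F]_N) :
  (x \in dual_code (row_code M)) = (x *m M^T == 0).
Proof.
apply/forallP/eqP => [dual_x | xM0 y]; last first.
  apply/implyP; rewrite mem_row_code => /submxP[u ->].
  by apply/eqP; rewrite dotp_mulmx trmx_mul mulmxA xM0 mul0mx mxE.
apply/rowP=> i; have /implyP := dual_x (row i M).
rewrite mem_row_code row_sub => /(_ isT)/eqP xi0.
rewrite [RHS]mxE -xi0 dotp_mulmx.
by rewrite tr_row colE mulmxA -colE [RHS]mxE.
Qed.

Lemma self_orthogonal_row_code (m N : nat) (M : 'M[F]_(m, N)) :
  M *m M^T = 0 -> self_orthogonal (row_code M).
Proof.
move=> M0 x; rewrite mem_row_code mem_dual_row_code => /submxP[u ->].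
by rewrite -mulmxA M0 mulmx0.
Qed.

(** The dual code is the kernel of [M^T], of dimension [N - \rank M], so a
    self-orthogonal code of half the length fills it. *)
Lemma self_dual_row_code (m N : nat) (M : 'M[F]_(m, N)) :
  M *m M^T = 0 -> (\rank M + \rank M = N)%N -> self_dual (row_code M).
Proof.
move=> M0 half x; rewrite mem_row_code mem_dual_row_code.
have sMK : (M <= kermx M^T)%MS by apply/sub_kermxP.
have /eqmxP eqMK : (M == kermx M^T)%MS.
  by rewrite -(mxrank_leqif_eq sMK) mxrank_ker mxrank_tr -[X in (X - _)%N]half
     addnK.
by rewrite eqMK; apply/sub_kermxP/eqP.
Qed.

Lemma gram_row_mx (m n1 n2 : nat) (X : 'M[F]_(m, n1)) (Y : 'M[F]_(m, n2)) :
  row_mx X Y *m (row_mx X Y)^T = X *m X^T + Y *m Y^T.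
Proof. by rewrite tr_row_mx mul_row_col. Qed.

Lemma gram_scalar (m : nat) (s : F) :
  (s%:M : 'M_m) *m (s%:M : 'M_m)^T = (s ^+ 2)%:M.
Proof. by rewrite tr_scalar_mx -scalar_mxM expr2. Qed.

Lemma gram_const (m : nat) (t : F) :
  (const_mx t : 'cV_m) *m (const_mx t : 'cV_m)^T = const_mx (t ^+ 2).
Proof. by apply/matrixP=> i j; rewrite !mxE big_ord1 !mxE expr2. Qed.

Lemma rank_row_mx_ge (m n1 n2 : nat) (X : 'M[F]_(m, n1)) (Y : 'M[F]_(m, n2)) :
  (\rank X <= \rank (row_mx X Y))%N.
Proof.
have {1}-> : X = row_mx X Y *m col_mx 1%:M 0.
  by rewrite mul_row_col mulmx1 mulmx0 addr0.
exact: mxrankM_maxl.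
Qed.

(** Columns already in the column space do not raise the rank. *)
Lemma rank_row_mx_image (m n1 n2 : nat) (X : 'M[F]_(m, n1))
    (Z : 'M[F]_(n1, n2)) :
  \rank (row_mx X (X *m Z)) = \rank X.
Proof.
apply/eqP; rewrite eqn_leq rank_row_mx_ge andbT.
have -> : row_mx X (X *m Z) = X *m row_mx 1%:M Z by rewrite mul_mx_row mulmx1.
exact: mxrankM_maxl.
Qed.

Lemma rank_row_scalar_mx (m n : nat) (s : F) (Y : 'M[F]_(m, n)) :
  s != 0 -> \rank (row_mx (s%:M : 'M_m) Y) = m.
Proof.
move=> nz_s; apply/eqP; rewrite eqn_leq rank_leq_row /=.
apply: leq_trans (rank_row_mx_ge _ _); rewrite mxrank_unit //.
by rewrite unitmxE det_scalar unitfE expf_neq0.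
Qed.

End RowCode.

(** * Counting incidences along orbits *)

Section Orbits.

Variables (V B : finType) (inc : V -> B -> bool).
Variables (G : {group {perm V} * {perm B}}) (autG : G \subset design_aut inc).
Variables (n m w : nat) (Vo : 'I_n -> {set V}) (Bo : 'I_m -> {set B}).
Hypotheses (enumV : enumerates Vo (point_orbits G))
           (enumB : enumerates Bo (block_orbits G)).

Local Notation toV := ('P \o @fst {perm V} {perm B})%act.
Local Notation toB := ('P \o @snd {perm V} {perm B})%act.
Local Notation O := (orbit_matrix inc Bo Vo).

Let sGV : G \subset act_dom toV.
Proof. by apply/subsetP=> g _; rewrite !inE. Qed.

Let sGB : G \subset act_dom toB.
Proof. by apply/subsetP=> g _; rewrite !inE. Qed.

Lemma sum_point_orbits (f : V -> nat) :
  (\sum_x f x = \sum_j \sum_(x in Vo j) f x)%N.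
Proof.
have [injV defV] := enumV.
have actsV : [acts G, on [set: V] | toV].
  by apply/subsetP=> g Gg; rewrite !inE; apply/subsetP=> x _; rewrite !inE.
transitivity (\sum_(x in [set: V]) f x)%N.
  by apply: eq_bigl => x; rewrite inE.
rewrite (set_partition_big _ (orbit_partition actsV)) /=.
have -> : [set orbit toV G x | x in [set: V]] = Vo @: [set: 'I_n].
  by rewrite defV.
rewrite big_imset /=; last exact: in2W.
by apply: eq_bigl => j; rewrite inE.
Qed.

(** An element of [G] taking [x] to [x'] maps the blocks of the orbit [Bo i]
    through [x] onto those through [x']. *)
Lemma card_blocks_orbit (i : 'I_m) (j : 'I_n) (x x' : V) :
  x \in Vo j -> x' \in Vo j ->
  #|Bo i :&: blocks_of inc x| = #|Bo i :&: blocks_of inc x'|.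
Proof.
have [_ defV] := enumV; have [_ defB] := enumB.
have /imsetP[y0 _ Dy0] : Bo i \in block_orbits G by rewrite -defB imset_f.
have /imsetP[x0 _ Dx0] : Vo j \in point_orbits G by rewrite -defV imset_f.
rewrite Dx0 => x0x x0x'.
have : x' \in orbit toV G x by move: x0x'; rewrite -(orbit_in_eqP sGV x0x).
case/orbitP=> g Gg <-.
have /(subsetP autG) := Gg; rewrite inE => /forallP Hg.
have Bg y : (g.2 y \in Bo i) = (y \in Bo i).
  by rewrite Dy0; apply: (orbit_actr_in _ _ _ sGB Gg).
rewrite -(card_imset _ (@perm_inj _ g.2)); apply: eq_card => y.
have Hy : (y \in Bo i :&: blocks_of inc (g.1 x))
        = (g.2^-1%g y \in Bo i :&: blocks_of inc x).
  have /forallP/(_ (g.2^-1%g y))/eqP := Hg x; rewrite permKV => Ieq.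
  by rewrite !inE -Ieq -[in RHS]Bg permKV.
rewrite [RHS]Hy; apply/imsetP/idP => [[y1 By1 ->] | By]; first by rewrite permK.
by exists (g.2^-1%g y); rewrite ?permKV.
Qed.

Lemma cardsI_sum (T : finType) (A C : {set T}) :
  #|A :&: C| = (\sum_(x in A) (x \in C))%N.
Proof.
rewrite -sum1_card big_mkcond [RHS]big_mkcond; apply: eq_bigr => x _.
by rewrite inE; case: (x \in A); case: (x \in C).
Qed.

Lemma orbit_matrix_row_sum (i : 'I_m) (y : B) :
  y \in Bo i -> (\sum_j O i j)%N = #|points_of inc y|.
Proof.
move=> Biy; rewrite -[points_of inc y]setTI cardsI_sum.
transitivity (\sum_x (x \in points_of inc y))%N.
  rewrite sum_point_orbits; apply: eq_bigr => j _.
  by rewrite (orbit_matrixE j autG enumB enumV Biy) cardsI_sum.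
by apply: eq_bigl => x; rewrite inE.
Qed.

Hypotheses (card_Vo : forall j, #|Vo j| = w) (card_Bo : forall i, #|Bo i| = w).

(** The incidences between [Vo j] and [Bo i] are counted from either side as
    [w] times a constant; since both orbits have length [w], the two constants
    agree. *)
Lemma orbit_matrix_dual (i : 'I_m) (j : 'I_n) (x : V) :
  x \in Vo j -> #|Bo i :&: blocks_of inc x| = O i j.
Proof.
move=> Vjx; have w_gt0 : (0 < w)%N.
  by rewrite -(card_Vo j); apply/card_gt0P; exists x.
apply/eqP; rewrite -(eqn_pmul2l w_gt0) -{1}(card_Vo j) -(card_Bo i).
rewrite -!sum_nat_const; apply/eqP.
transitivity (\sum_(x' in Vo j) \sum_(y in Bo i) inc x' y)%N.
  apply: eq_bigr => x' Vjx'; rewrite (card_blocks_orbit i Vjx Vjx') cardsI_sum.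
  by apply: eq_bigr => y _; rewrite inE.
rewrite exchange_big /=; apply: eq_bigr => y Biy.
rewrite (orbit_matrixE j autG enumB enumV Biy) cardsI_sum.
by apply: eq_bigr => x' _; rewrite inE.
Qed.

(** Each point [x] of [y] in [Vo j] lies on [O i' j] blocks of [Bo i'], and
    [O i j] points of [y] are in [Vo j]; so both sides count the pairs formed by
    a block [y'] of [Bo i'] and a common point of [y] and [y']. *)
Lemma orbit_matrix_gram (i i' : 'I_m) (y : B) :
  y \in Bo i ->
  (\sum_j O i j * O i' j)%N
    = (\sum_(y' in Bo i') #|points_of inc y :&: points_of inc y'|)%N.
Proof.
move=> Biy; symmetry.
transitivity (\sum_x \sum_(y' in Bo i') (x \in points_of inc y) * inc x y')%N.
  rewrite exchange_big; apply: eq_bigr => y' _; rewrite cardsI_sum big_mkcond.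
  apply: eq_bigr => x _; rewrite !inE.
  by case: (inc x y); rewrite ?mul1n ?mul0n.
rewrite sum_point_orbits; apply: eq_bigr => j _.
rewrite (orbit_matrixE j autG enumB enumV Biy) cardsI_sum big_distrl /=.
apply: eq_bigr => x Vjx; rewrite -big_distrr /=; congr (_ * _)%N.
rewrite -(orbit_matrix_dual i' Vjx) cardsI_sum.
by apply: eq_bigr => y' _; rewrite inE.
Qed.

Variables (p : nat) (p_prime : prime p) (k : nat) (a d : 'F_p).
Hypothesis block_size : forall y, #|points_of inc y| = k.
Hypothesis k_mod : k%:R = a.
Hypothesis inter_mod : forall y y' : B, y != y' ->
  #|points_of inc y :&: points_of inc y'|%:R = d.
Variables (F : finFieldType) (charF : p \in [pchar F]).

Lemma block_orbit_inhabited (i : 'I_m) : exists y, y \in Bo i.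
Proof.
have [_ defB] := enumB.
have /imsetP[y0 _ ->] : Bo i \in block_orbits G by rewrite -defB imset_f.
by exists y0; apply: orbit_refl.
Qed.

Lemma block_orbit_inj (i i' : 'I_m) (y : B) : y \in Bo i -> y \in Bo i' -> i = i'.
Proof.
have [injB defB] := enumB.
have /imsetP[y0 _ D] : Bo i \in block_orbits G by rewrite -defB imset_f.
have /imsetP[y1 _ D'] : Bo i' \in block_orbits G by rewrite -defB imset_f.
rewrite D D' => /(orbit_in_eqP sGB) E /(orbit_in_eqP sGB) E'.
by apply: injB; rewrite D D' -E -E'.
Qed.

(** Off the diagonal, [y] meets [w] other blocks, each in [d] points modulo
    [p]; on the diagonal, it meets itself in [a] points and [w - 1] others in
    [d], which gives [a + (w - 1) d = (a - d) + w d]. *)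
Lemma gram_orbit_mx :
  nat_mx F O *m (nat_mx F O)^T
    = (in_field F (a - d))%:M + const_mx (in_field F (w%:R * d)).
Proof.
apply/matrixP=> i i'; rewrite !mxE.
transitivity ((\sum_j O i j * O i' j)%N%:R : F).
  by rewrite natr_sum; apply: eq_bigr => j _; rewrite !mxE natrM.
have [y Biy] := block_orbit_inhabited i.
rewrite (orbit_matrix_gram i' Biy) -(in_field_nat p_prime charF) natr_sum.
have [<- | neq_ii'] := eqVneq i i'; last first.
  rewrite mulr0n add0r -(card_Bo i') mulr_natl -sumr_const; congr in_field.
  apply: eq_bigr => y' Bi'y'; apply: inter_mod.
  apply: contraNneq neq_ii' => eq_y.
  by apply/eqP/(block_orbit_inj Biy); rewrite eq_y.
rewrite mulr1n -in_fieldD //; congr in_field.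
rewrite (bigD1 y) //= setIid block_size k_mod -addrA; congr (_ + _).
rewrite -(card_Bo i) mulr_natl -sumr_const [X in _ = _ + X](bigD1 y) //= addKr.
by apply: eq_bigr => y' /andP[_ ne]; apply: inter_mod; rewrite eq_sym.
Qed.

Lemma orbit_mx_row_sum :
  nat_mx F O *m (const_mx 1 : 'cV_n) = const_mx (in_field F a).
Proof.
apply/matrixP=> i o; rewrite !mxE.
have [y Biy] := block_orbit_inhabited i.
rewrite -k_mod in_field_nat // -(block_size y) -(orbit_matrix_row_sum Biy).
rewrite natr_sum.
by apply: eq_bigr => j _; rewrite !mxE mulr1.
Qed.

End Orbits.

(** * Self-orthogonal codes from orbit matrices *)

Theorem theorem19
  (p l : nat) (p_prime : prime p) (l_gt0 : (0 < l)%N)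
  (Fq : finFieldType) (card_Fq : #|Fq| = (p ^ l)%N)
  (V B : finType) (inc : V -> B -> bool) (v k r : nat)
  (design : one_design inc v k r)
  (a d : 'F_p) (k_mod : k%:R = a)
  (inter_mod : forall y y' : B, y != y' ->
     #|points_of inc y :&: points_of inc y'|%:R = d)
  (G : {group {perm V} * {perm B}}) (autG : G \subset design_aut inc)
  (n m w : nat) (Vo : 'I_n -> {set V}) (Bo : 'I_m -> {set B})
  (enumV : enumerates Vo (point_orbits G))
  (enumB : enumerates Bo (block_orbits G))
  (card_Vo : forall j, #|Vo j| = w) (card_Bo : forall i, #|Bo i| = w) :
  let O := orbit_matrix inc Bo Vo in
  let wd : 'F_p := w%:R * d in
  (a = d ->
    ((p %| w)%N ->
       self_orthogonal_code (\rank (nat_mx Fq O)) (row_code (nat_mx Fq O)))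
    /\
    (~~ (p %| w)%N ->
       forall F : finFieldType, sqrt_field Fq F [:: - wd] ->
       (exists s : F, is_sqrt (- wd) s) /\
       (forall s : F, is_sqrt (- wd) s ->
          self_orthogonal_code (\rank (nat_mx F O))
            (row_code (row_mx (nat_mx F O) (const_mx s : 'cV_m))))))
  /\
  (a <> d ->
    ((p %| w)%N ->
       forall F : finFieldType, sqrt_field Fq F [:: d - a] ->
       (exists s : F, is_sqrt (d - a) s) /\
       (forall s : F, is_sqrt (d - a) s ->
          let C := row_code (row_mx (s%:M : 'M_m) (nat_mx F O)) in
          self_orthogonal_code m C /\ (m = n -> self_dual C)))
    /\
    ((p %| w%:Z - 1)%Z ->
       forall F : finFieldType, sqrt_field Fq F [:: wd - a; - wd] ->
       ((exists s : F, is_sqrt (wd - a) s) /\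
        (exists t : F, is_sqrt (- wd) t)) /\
       (forall s t : F, is_sqrt (wd - a) s -> is_sqrt (- wd) t ->
          self_orthogonal_code m
            (row_code (row_mx (row_mx (s%:M : 'M_m) (nat_mx F O))
                              (const_mx t : 'cV_m)))))
    /\
    (~~ (p %| w)%N -> ~~ (p %| w%:Z - 1)%Z ->
       forall F : finFieldType, sqrt_field Fq F [:: d - a; - wd] ->
       ((exists s : F, is_sqrt (d - a) s) /\
        (exists t : F, is_sqrt (- wd) t)) /\
       (forall s t : F, is_sqrt (d - a) s -> is_sqrt (- wd) t ->
          self_orthogonal_code m
            (row_code (row_mx (row_mx (s%:M : 'M_m) (nat_mx F O))
                              (const_mx t : 'cV_m)))))).
Proof.
move=> O wd.
have [_ block_size _] := design.
have gram (F : finFieldType) (charF : p \in [pchar F]) :=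
  gram_orbit_mx autG enumV enumB card_Vo card_Bo p_prime block_size k_mod
    inter_mod charF.
have p_w0 : (p %| w)%N -> wd = 0.
  by rewrite (dvdn_pcharf (pchar_Fp p_prime)) /wd => /eqP->; rewrite mul0r.
have charq := card_finPcharP card_Fq p_prime.
split=> [eq_ad | neq_ad].
  have ad0 : a - d = 0 by rewrite eq_ad subrr.
  split=> [/p_w0 wd0 | _ F sF].
    split; last exact: dim_row_code.
    apply: self_orthogonal_row_code.
    by rewrite gram // -/wd wd0 ad0 !in_field0 raddf0 add0r.
  have charF := sqrt_field_pchar p_prime card_Fq sF.
  split=> [|s sqrt_s].
    exact: sqrt_field_sqrt p_prime card_Fq sF (mem_head _ _).
  split.
    apply: self_orthogonal_row_code.
    rewrite gram_row_mx gram_const gram // sqrt_s -/wd ad0 in_field0 raddf0.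
    by apply/matrixP=> i j; rewrite !mxE in_fieldN // add0r addrN.
  rewrite dim_row_code.
  (* The row sums of O are a = d, so the added column is O times s / d times
     the all-one column; if d = 0, then s = 0 and the added column is zero. *)
  have [d0 | nz_d] := eqVneq d 0.
    have /eqP : s ^+ 2 = 0.
      by rewrite sqrt_s; apply/eqP; rewrite in_field_eq0 // /wd d0 mulr0 oppr0.
    rewrite expf_eq0 /= => /eqP->.
    exact: rank_row_mx0.
  have nzF : in_field F d != 0 by rewrite in_field_eq0.
  have -> : const_mx s
      = nat_mx F O *m ((s / in_field F d) *: const_mx 1 : 'cV_n).
    rewrite -scalemxAr.
    rewrite (orbit_mx_row_sum autG enumV enumB p_prime block_size k_mod charF).
    by rewrite eq_ad; apply/matrixP=> i j; rewrite !mxE divfK.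
  exact: rank_row_mx_image.
have nz_da : d - a != 0 by rewrite subr_eq0 eq_sym; apply/eqP.
have sqrt_neq0 (F : finFieldType) (c : 'F_p) (s : F) :
    p \in [pchar F] -> c != 0 -> is_sqrt c s -> s != 0.
  move=> charF nz_c sc; have : s ^+ 2 != 0 by rewrite sc in_field_eq0.
  by rewrite expf_eq0.
(* The code of the last case; it also covers p %| w - 1, where wd = d. *)
have code_sqrt2 (F : finFieldType) (s t : F) : p \in [pchar F] ->
    is_sqrt (d - a) s -> is_sqrt (- wd) t ->
    self_orthogonal_code m
      (row_code (row_mx (row_mx (s%:M : 'M_m) (nat_mx F O))
                        (const_mx t : 'cV_m))).
  move=> charF ss tt; split.
    apply: self_orthogonal_row_code.
    rewrite !gram_row_mx gram_scalar gram_const gram // ss tt -/wd -(opprB a d).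
    by apply/matrixP=> i j; rewrite !mxE !in_fieldN // mulNrn addKr addrN.
  rewrite dim_row_code; apply/eqP; rewrite eqn_leq rank_leq_row /=.
  apply: leq_trans (rank_row_mx_ge _ _).
  by rewrite rank_row_scalar_mx ?(sqrt_neq0 _ _ _ charF nz_da ss).
split=> [/p_w0 wd0 F sF|].
  have charF := sqrt_field_pchar p_prime card_Fq sF.
  split=> [|s sqrt_s C].
    exact: sqrt_field_sqrt p_prime card_Fq sF (mem_head _ _).
  have nz_s := sqrt_neq0 _ _ _ charF nz_da sqrt_s.
  have gram0 : row_mx (s%:M : 'M_m) (nat_mx F O)
               *m (row_mx (s%:M : 'M_m) (nat_mx F O))^T = 0.
    rewrite gram_row_mx gram_scalar gram // sqrt_s -/wd wd0 -(opprB a d).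
    rewrite in_fieldN // raddfN addKr.
    by apply/matrixP=> i j; rewrite !mxE in_field0.
  have rank_m := rank_row_scalar_mx (nat_mx F O) nz_s.
  split.
    by split; [exact: self_orthogonal_row_code | rewrite dim_row_code].
  by move=> mn; apply: self_dual_row_code; rewrite // rank_m {2}mn.
split=> [p_w1 | _ _] F sF.
  have charF := sqrt_field_pchar p_prime card_Fq sF.
  have wd_d : wd = d.
    rewrite /wd; have /dvdzP[z wz] := p_w1.
    have : (w%:Z - 1)%:~R = 0 :> 'F_p.
      by rewrite wz intrM -[X in _ * X]/(p%:R) pchar_Fp_0 // mulr0.
    rewrite intrB => /eqP; rewrite subr_eq0 => /eqP w1.
    by rewrite -[w%:R]/(w%:Z%:~R) w1 mul1r.
  split.
    by split; apply: (sqrt_field_sqrt p_prime card_Fq sF);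
       rewrite !inE eqxx ?orbT.
  by rewrite {1}wd_d => s t; apply: code_sqrt2.
have charF := sqrt_field_pchar p_prime card_Fq sF.
split.
  by split; apply: (sqrt_field_sqrt p_prime card_Fq sF);
     rewrite !inE eqxx ?orbT.
by move=> s t; apply: code_sqrt2.
Qed.
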